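(* For any integers $0 \leq k \leq n$ and any finite field $\mathbb{F}_q$, the map $$\operatorname{alt} \circ \perp : \operatorname{Gr}^{\geq 0}_{k,n}(\mathbb{F}_q) \to \operatorname{Gr}^{\geq 0}_{n-k,n}(\mathbb{F}_q), \qquad V \mapsto \operatorname{alt}(V^{\perp}),$$ is a well-defined bijection, and thus $$|\operatorname{Gr}^{\geq 0}_{k,n}(\mathbb{F}_q)| = |\operatorname{Gr}^{\geq 0}_{n-k,n}(\mathbb{F}_q)|.$$
   Context: $\mathbb{F}_q$ is the finite field with $q = p^r$ elements ($p$ prime, $r \geq 1$). For $a \in \mathbb{F}_q$, write $a \geq 0$ if $a = x^2$ for some $x \in \mathbb{F}_q$. For a field $\mathbb{F}$, $\operatorname{Gr}_{k,n}(\mathbb{F})$ is the set of $k$-dimensional subspaces of $\mathbb{F}^n$. For a full rank $k \times n$ matrix $A$, $[A]$ denotes its row span, and for a $k$-element subset $I$ of $[n]=\{1,\dots,n\}$, $\Delta_I(A)$ is the $k \times k$ minor of $A$ using the columns indexed by $I$ (in increasing order). The totally nonnegative finite Grassmannian is $$\operatorname{Gr}_{k,n}^{\geq 0}(\mathbb{F}_q) = \{V \in \operatorname{Gr}_{k,n}(\mathbb{F}_q) : \text{there is a matrix } A \text{ with } [A] = V \text{ and } \Delta_I(A) \geq 0 \text{ for all } k\text{-element } I \subseteq [n]\}.$$ For $V = [A] \in \operatorname{Gr}_{k,n}(\mathbb{F})$, $V^{\perp} \in \operatorname{Gr}_{n-k,n}(\mathbb{F})$ is the null space of $A$ (equivalently,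 the orthogonal complement of $V$ for the standard dot product). The map $\operatorname{alt} : \mathbb{F}^n \to \mathbb{F}^n$ is $\operatorname{alt}((v_1, v_2, \dots, v_n)) = (v_1, -v_2, v_3, \dots, (-1)^{n-1} v_n)$, and $\operatorname{alt}(V) = \{\operatorname{alt}(v) : v \in V\}$ for a subspace $V$. *)

(* Defs.v *)
From HB Require Import structures.
From mathcomp Require Import all_boot all_order all_algebra.

Set Implicit Arguments.
Unset Strict Implicit.
Unset Printing Implicit Defensive.

Import GRing.Theory.
Import VectorInternalTheory.
Local Open Scope ring_scope.

(* There are finitely many subspaces over a finite field; this instance gives
   access to {set {vspace vT}} and to cardinals of sets of subspaces. *)
Section FiniteVspace.
Variables (F : finFieldType) (vT : vectType F).
HB.instance Definition _ := [Countable of space vT by <:].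
HB.instance Definition _ := [Finite of space vT by <:].
End FiniteVspace.

Definition ksubset (k n : nat) : Type := {I : {set 'I_n} | #|I| == k}.
HB.instance Definition _ (k n : nat) := Finite.on (ksubset k n).

Section Grassmannian.
Variable F : finFieldType.

Definition sq_ge0 (a : F) : bool := [exists x : F, a == x ^+ 2].

Definition Gr (k n : nat) : {set {vspace 'rV[F]_n}} :=
  [set V : {vspace 'rV[F]_n} | \dim V == k].

Definition rowspan k n (A : 'M[F]_(k, n)) : {vspace 'rV[F]_n} :=
  <<[seq row i A | i : 'I_k]>>%VS.

(* enum_val lists the elements of I in increasing order, because enum 'I_n
   does. *)
Definition kcol k n (I : ksubset k n) (j : 'I_k) : 'I_n :=
  enum_val (cast_ord (esym (eqP (valP I))) j).

Definition kminor k n (A : 'M[F]_(k, n)) (I : ksubset k n) : F :=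
  \det (colsub (kcol I) A).

(* Full rank of A is automatic: its k rows span the k-dimensional V. *)
Definition Gr_ge0 (k n : nat) : {set {vspace 'rV[F]_n}} :=
  [set V in Gr k n |
    [exists A : 'M[F]_(k, n),
      (rowspan A == V) && [forall I : ksubset k n, sq_ge0 (kminor A I)]]].

Definition perp n (V : {vspace 'rV[F]_n}) : {vspace 'rV[F]_n} :=
  (\bigcap_(v in V) lker (linfun (@mulmxr F 1 n 1 v^T)))%VS.

(* With 0-based indices the sign of the j-th coordinate is (-1)^j. *)
Definition alt n (v : 'rV[F]_n) : 'rV[F]_n :=
  \row_(j < n) ((-1) ^+ j * v 0 j).

Fact alt_is_linear n : linear (@alt n).
Proof.
by move=> a u v; apply/rowP=> j; rewrite !mxE mulrDr !mulrA [a * _]mulrC.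
Qed.

HB.instance Definition _ n :=
  GRing.isLinear.Build F 'rV[F]_n 'rV[F]_n *:%R (@alt n) (@alt_is_linear n).

Definition altv n (V : {vspace 'rV[F]_n}) : {vspace 'rV[F]_n} :=
  (linfun (@alt n) @: V)%VS.

Lemma sq_ge0P (a : F) : reflect (exists x : F, a = x ^+ 2) (sq_ge0 a).
Proof. exact: 'exists_eqP. Qed.

Lemma kcol_mono k n (I : ksubset k n) (i j : 'I_k) :
  (i < j)%N -> (kcol I i < kcol I j)%N.
Proof.
case: I => I cI lt_ij; rewrite /kcol /=.
have sz : size (enum I) = k by rewrite -cardE; apply/eqP.
have x0 : 'I_n := enum_val (cast_ord (esym (eqP cI)) i).
rewrite !(enum_val_nth x0) /=.
have srt : sorted (fun a b : 'I_n => (a < b)%N) (enum I).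
  rewrite /enum_mem; apply: sorted_filter => [a b c|]; first exact: ltn_trans.
  rewrite -enumT; have := iota_ltn_sorted 0 n.
  by rewrite -val_enum_ord sorted_map.
have tr : transitive (fun a b : 'I_n => (a < b)%N).
  by move=> a b c; apply: ltn_trans.
by apply: (sorted_ltn_nth tr x0 srt); rewrite ?inE ?sz.
Qed.

Lemma memv_perpP n (V : {vspace 'rV[F]_n}) (w : 'rV[F]_n) :
  reflect (forall v, v \in V -> w *m v^T = 0) (w \in perp V).
Proof.
have E v : (w \in lker (linfun (@mulmxr F 1 n 1 v^T)))
           = (w *m v^T == 0).
  by rewrite memv_ker (lfunE (mulmxr v^T)).
apply: (iffP idP) => [wV v vV | H].
  by apply/eqP; rewrite -E; apply: subvP wV; apply: bigcapv_inf vV _.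
rewrite memvE; apply/subv_bigcapP => v vV; rewrite -memvE E.
by rewrite H.
Qed.

Lemma memv_perp_rowspan k n (A : 'M[F]_(k, n)) (w : 'rV[F]_n) :
  (w \in perp (rowspan A)) = (A *m w^T == 0).
Proof.
apply/memv_perpP/eqP => [H | H v].
  apply/row_matrixP => i; rewrite row_mul row0.
  apply: trmx_inj; rewrite trmx_mul trmxK trmx0; apply: H.
  by apply/memv_span/imageP; exists i.
have E u : (u \in lker (linfun (mulmxr w^T))) = (u *m w^T == 0).
  by rewrite memv_ker lfunE.
suff /subvP sub : (rowspan A <= lker (linfun (mulmxr w^T)))%VS.
  move=> /sub; rewrite E => /eqP vw.
  by apply: trmx_inj; rewrite trmx_mul trmxK trmx0.
apply/span_subvP => _ /imageP[i _ ->].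
by rewrite E -row_mul H row0.
Qed.

Lemma memv_altP n (V : {vspace 'rV[F]_n}) (w : 'rV[F]_n) :
  reflect (exists2 v, v \in V & w = alt v) (w \in altv V).
Proof.
by apply: (iffP memv_imgP) => -[v vV ->]; exists v => //; rewrite lfunE.
Qed.

End Grassmannian.

(* Main.v *)
Require Import Defs.
From mathcomp Require Import all_boot all_order all_algebra all_fingroup.

(** Extend a full rank matrix A, with row span V, to an invertible matrix M
whose first k rows are A, and let Q be the last m = n - k columns of the
inverse of M.  Then A Q = 0, so the rows of Q^T span the orthogonal complement
of V.  The maximal minors of A and of Q^T are related by Jacobi's
complementary minor identity
  det A_I = det M * sign(s) * det (Q^T)_J,
where J is the complement of I and s is the shuffle listing I and then J, both
in increasing order ([complementary_minor]).

The sign of s is (-1)^(sum of I), up to a sign depending on k alone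
([odd_shuffle]).  Negating every other column multiplies the minor on the
columns J by (-1)^(sum of J).  The two sums add up to a constant, so
for alt(Q^T), whose rows span alt(V^perp), the minor on J is a constant
multiple of the minor of A on I, the constant being nonzero and the same for
all I ([dual_kminor]).  That constant is absorbed into a single row of the
matrix ([Gr_ge0_rowspan]), after which all the minors are squares when those of
A are.  Hence alt o perp maps the nonnegative Grassmannian to the dual one;
it is a bijection because alt and perp commute and are involutions, so that
applying alt o perp twice gives back V. *)

Set Implicit Arguments.
Unset Strict Implicit.
Unset Printing Implicit Defensive.

Import GRing.Theory.
Local Open Scope ring_scope.

(** * The sign of a shuffle *)

Lemma lift_perm_surj n (s : 'S_n.+1) :
  exists s' : 'S_n, s = lift_perm ord0 (s ord0) s'.
Proof.
have neq i : s ord0 != s (lift ord0 i) by rewrite (inj_eq perm_inj) neq_lift.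
pose f i := s2val (unlift_some (neq i)).
have fE i : s (lift ord0 i) = lift (s ord0) (f i).
  by rewrite /f; case: (unlift_some _).
have f_inj : injective f.
  move=> i j eq_f; apply: (@lift_inj _ ord0); apply: (@perm_inj _ s).
  by rewrite !fE eq_f.
exists (perm f_inj); apply/permP => i.
case: (unliftP ord0 i) => [j|] ->; last by rewrite lift_perm_id.
by rewrite lift_perm_lift permE fE.
Qed.

(** An increasing self-map of an initial segment is inflationary; applied to
both s and its inverse this gives equality. *)
Lemma increasing_perm1 n (s : 'S_n) :
  (forall i j : 'I_n, (i < j)%N -> (s i < s j)%N) -> s = 1%g.
Proof.
have le_incr (t : 'S_n) :
    (forall i j : 'I_n, (i < j)%N -> (t i < t j)%N) ->
    forall i : 'I_n, (i <= t i)%N.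
  move=> t_incr [i]; elim: i => [|i IHi] lt_in //=.
  by apply: leq_ltn_trans (IHi (ltnW lt_in)) (t_incr _ _ _).
move=> s_incr; apply/permP => i; rewrite perm1; apply/val_inj/eqP.
rewrite eqn_leq [X in _ && X]le_incr // andbT.
rewrite -[X in (_ <= nat_of_ord X)%N](permK s); apply: le_incr => a b lt_ab.
rewrite ltnNge; apply: contraL lt_ab; rewrite -leqNgt leq_eqVlt => /orP[/eqP|].
  by move/val_inj/perm_inj ->.
by move/s_incr; rewrite !permKV => /ltnW.
Qed.

(** Removing the first value s 0 from s leaves a smaller shuffle s', and
changes the parity by s 0.  The other values of the first block all exceed s 0,
so each drops by one in s', as does each index: the two shifts of the sums
cancel modulo 2. *)
Lemma odd_shuffle k m (s : 'S_(k + m)) :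
  (forall i j : 'I_(k + m), (i < j)%N -> (j < k)%N || (k <= i)%N ->
     (s i < s j)%N) ->
  odd_perm s = odd (\sum_(i < k) s (lshift m i) + \sum_(i < k) i)%N.
Proof.
elim: k s => [|k IHk] s s_incr.
  rewrite !big_ord0 (_ : s = 1%g) ?odd_perm1 //.
  by apply: increasing_perm1 => i j lt_ij; apply: s_incr; rewrite ?orbT.
have [s' def_s] := lift_perm_surj (s : 'S_(k + m).+1).
have sE i : s (lift ord0 i) = lift (s ord0) (s' i).
  by rewrite {1}def_s lift_perm_lift.
have s'_incr (i j : 'I_(k + m)) : (i < j)%N -> (j < k)%N || (k <= i)%N ->
    (s' i < s' j)%N.
  move=> lt_ij ijk.
  have : (s (lift ord0 i) < s (lift ord0 j))%N.
    by apply: s_incr; rewrite !lift0 ?ltnS.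
  by rewrite !sE /= ltnNge leq_bump2 -ltnNge.
have sumE : (\sum_(i < k.+1) s (lshift m i) =
    s ord0 + \sum_(i < k) s' (lshift m i) + k)%N.
  rewrite big_ord_recl (_ : lshift m ord0 = ord0); last exact: val_inj.
  rewrite -addnA; congr addn.
  have -> x : (x + k = x + \sum_(i < k) 1)%N by rewrite sum1_card card_ord.
  rewrite -big_split; apply: eq_bigr => i _.
  rewrite (_ : lshift m _ = lift ord0 (lshift m i) :> 'I_(k.+1 + m)); last first.
    exact: val_inj.
  have : (s ord0 < s (lift ord0 (lshift m i)))%N.
    by apply: s_incr; rewrite ?lift0 //= ltnS ltn_ord.
  rewrite sE /= /bump addn1; case: (leqP (s ord0)) => // lt_s.
  by rewrite ltnNge ltnW.
have sumI : (\sum_(i < k.+1) i = \sum_(i < k) i + k)%N by rewrite big_ord_recr.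
rewrite sumE sumI {1}def_s odd_lift_perm IHk // !oddD.
by case: (odd k); rewrite /= ?addbT ?addbF ?addbN ?addNb ?negbK -?addbA.
Qed.

(** * Row spans, perp and alt *)

Section Duality.
Variable F : finFieldType.

Lemma mem_rowspan k n (A : 'M[F]_(k, n)) (w : 'rV[F]_n) :
  (w \in rowspan A) = (w <= A)%MS.
Proof.
apply/idP/submxP => [|[u ->]].
  have E u : (u \in limg (linfun (@mulmxr F 1 k n A))) <-> exists x, u = x *m A.
    split=> [/memv_imgP[x _ ->]|[x ->]]; first by exists x; rewrite lfunE.
    by apply/memv_imgP; exists x; rewrite ?memvf // lfunE.
  suff /subvP sub : (rowspan A <= limg (linfun (@mulmxr F 1 k n A)))%VS.
    by move/sub/E.
  apply/span_subvP => _ /imageP[i _ ->]; apply/E.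
  by exists (delta_mx 0 i); rewrite rowE.
rewrite mulmx_sum_row; apply: memv_suml => i _; apply: memvZ.
by apply/memv_span/imageP; exists i.
Qed.

Lemma dim_rowspan k n (A : 'M[F]_(k, n)) :
  (\dim (rowspan A) == k) = row_free A.
Proof.
have sz : size [seq row i A | i : 'I_k] == k by rewrite size_image card_ord.
rewrite -[X in _ == X](eqP sz) -/(free (Tuple sz)).
have nthE (i : 'I_k) : (Tuple sz)`_i = row i A.
  rewrite (nth_map i) ?size_enum_ord //; congr (row _ A).
  exact: nth_ord_enum.
apply/freeP/idP => [A_free|A_free c c0 i].
  apply/inj_row_free => v; rewrite mulmx_sum_row => v0.
  apply/rowP => i; rewrite mxE; apply: (A_free (v 0)).
  by rewrite -[RHS]v0; apply: eq_bigr => j _; rewrite nthE.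
have : \row_j c j *m A = 0 *m A.
  rewrite mul0mx -c0 mulmx_sum_row; apply: eq_bigr => j _.
  by rewrite nthE mxE.
by move/(row_free_inj A_free)/rowP/(_ i); rewrite !mxE.
Qed.

Lemma altK n : involutive (@alt F n).
Proof.
by move=> v; apply/rowP => j; rewrite !mxE mulrA -expr2 sqrr_sign mul1r.
Qed.

Lemma altvK n : involutive (@altv F n).
Proof.
move=> V; apply/vspaceP => w.
apply/memv_altP/idP => [[_ /memv_altP[v vV ->] ->]|wV].
  by rewrite altK.
by exists (alt w); rewrite ?altK //; apply/memv_altP; exists w.
Qed.

Lemma mem_altv n (V : {vspace 'rV[F]_n}) w : (w \in altv V) = (alt w \in V).
Proof.
apply/memv_altP/idP => [[v vV ->]|wV]; first by rewrite altK.
by exists (alt w); rewrite ?altK.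
Qed.

(** The map alt is self-adjoint for the dot product. *)
Lemma perp_altv n (V : {vspace 'rV[F]_n}) : perp (altv V) = altv (perp V).
Proof.
have dotE (u v : 'rV[F]_n) : u *m (alt v)^T = alt u *m v^T.
  apply/rowP => i; rewrite !mxE; apply: eq_bigr => j _.
  by rewrite !mxE mulrCA mulrA ord1.
apply/vspaceP => w; rewrite mem_altv.
apply/memv_perpP/memv_perpP => wP v vV.
  by rewrite -dotE wP // mem_altv altK.
by rewrite -[v]altK dotE wP // -mem_altv.
Qed.

(** * Orthogonal complements and complementary minors *)

(** Gaussian elimination writes A as L (1 0) U with L and U invertible, and
diag(L, 1) U is then an invertible extension of A. *)
Lemma row_free_complete k m (A : 'M[F]_(k, k + m)) : row_free A ->
  exists2 M : 'M[F]_(k + m), M \in unitmx & usubmx M = A.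
Proof.
move=> A_free; exists (block_mx (col_ebase A) 0 0 1%:M *m row_ebase A).
  rewrite unitmx_mul row_ebase_unit andbT unitmxE det_lblock det1 mulr1.
  by rewrite -unitmxE col_ebase_unit.
rewrite -mul_usub_mx block_mxEv col_mxKu -[RHS]mulmx_ebase (eqP A_free).
by rewrite pid_mx_row mul_mx_row mulmx1 mulmx0.
Qed.

Lemma usub_rsub_invmx k m (M : 'M[F]_(k + m)) : M \in unitmx ->
  usubmx M *m rsubmx (invmx M) = 0.
Proof.
move=> uM; rewrite mulmx_rsub mul_usub_mx mulmxV // (@scalar_mx_block _ k m).
by rewrite block_mxEv col_mxKu row_mxKr.
Qed.

Lemma dsub_rsub_invmx k m (M : 'M[F]_(k + m)) : M \in unitmx ->
  dsubmx M *m rsubmx (invmx M) = 1%:M.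
Proof.
move=> uM; rewrite mulmx_rsub mul_dsub_mx mulmxV // (@scalar_mx_block _ k m).
by rewrite block_mxEv col_mxKd row_mxKr.
Qed.

(** If M w^T vanishes on the first k rows, applying the inverse of M expresses
w^T through the last m columns of that inverse. *)
Lemma perp_rowspan_unit k m (M : 'M[F]_(k + m)) : M \in unitmx ->
  perp (rowspan (usubmx M)) = rowspan (rsubmx (invmx M))^T.
Proof.
move=> uM; apply/vspaceP => w; rewrite memv_perp_rowspan mem_rowspan.
apply/eqP/submxP => [w0|[u ->]].
  exists (dsubmx M *m w^T)^T; apply: trmx_inj; rewrite -trmx_mul trmxK.
  have Mw : M *m w^T = col_mx 0 (dsubmx M *m w^T).
    by rewrite -{1}(vsubmxK M) mul_col_mx w0.
  rewrite -[LHS](mulKmx uM) Mw -{1}(hsubmxK (invmx M)).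
  by rewrite mul_row_col mulmx0 add0r.
by rewrite trmx_mul trmxK mulmxA usub_rsub_invmx // mul0mx.
Qed.

(** A vector w orthogonal to the last m columns of the inverse of M has
coordinates w M^-1 supported on the first k rows of M. *)
Lemma perp_perp_rowspan k m (A : 'M[F]_(k, k + m)) : row_free A ->
  perp (perp (rowspan A)) = rowspan A.
Proof.
case/row_free_complete=> M uM <-; rewrite perp_rowspan_unit //.
apply/vspaceP => w; rewrite memv_perp_rowspan mem_rowspan -trmx_mul.
apply/eqP/submxP => [wQt|[u ->]]; last first.
  by rewrite -mulmxA usub_rsub_invmx // mulmx0 trmx0.
have wQ : w *m rsubmx (invmx M) = 0 by rewrite -[LHS]trmxK wQt trmx0.
exists (w *m lsubmx (invmx M)).
have wN : w *m invmx M = row_mx (w *m lsubmx (invmx M)) 0.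
  by rewrite -{1}(hsubmxK (invmx M)) mul_mx_row wQ.
rewrite -[LHS](mulmxKV uM) wN -{2}(vsubmxK M).
by rewrite mul_row_col mul0mx addr0.
Qed.

(** Jacobi's identity, for any split of the columns by a permutation s.  Let N
consist of the unit columns with indices in the first block, followed by the
last m columns of the inverse of M.  Then M N is block lower triangular with
determinant the left-hand minor, while permuting the rows of N by s makes it
block upper triangular with determinant the right-hand minor. *)
Lemma complementary_minor k m (M : 'M[F]_(k + m)) (s : 'S_(k + m)) :
  M \in unitmx ->
  \det (colsub (fun i => s (lshift m i)) (usubmx M)) =
  \det M * ((-1) ^+ s *
            \det (colsub (fun j => s (rshift k j)) (rsubmx (invmx M))^T)).
Proof.
move=> uM; set f := fun i => s (lshift m i); set g := fun j => s (rshift k j).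
set Q := rsubmx (invmx M); pose N := row_mx (colsub f 1%:M) Q.
have detN : \det N = (-1) ^+ s * \det (colsub g Q^T).
  have sN : row_perm s N = block_mx 1%:M (rowsub f Q) 0 (rowsub g Q).
    apply/matrixP => i j; rewrite -[i]splitK -[j]splitK mxE.
    case: (split i) (split j) => [a|a] [b|b] /=.
    - by rewrite block_mxEul row_mxEl !mxE (inj_eq perm_inj) eq_lshift.
    - by rewrite block_mxEur row_mxEr !mxE.
    - by rewrite block_mxEdl row_mxEl !mxE (inj_eq perm_inj) eq_rlshift.
    - by rewrite block_mxEdr row_mxEr !mxE.
  have := congr1 determinant sN.
  rewrite row_permE det_mulmx det_perm det_ublock det1 mul1r => detsN.
  have -> : \det (colsub g Q^T) = \det (rowsub g Q).
    by rewrite -det_tr; congr (\det _); apply/matrixP => i j; rewrite !mxE.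
  by rewrite -detsN mulrA -expr2 sqrr_sign mul1r.
rewrite -detN -det_mulmx -{2}(vsubmxK M) mul_col_row.
rewrite usub_rsub_invmx // dsub_rsub_invmx // det_lblock det1 mulr1.
by rewrite mulmx_colsub mulmx1.
Qed.

Definition alt_mx k n (A : 'M[F]_(k, n)) : 'M[F]_(k, n) :=
  A *m diag_mx (\row_j (-1) ^+ j).

Lemma altv_rowspan k n (A : 'M[F]_(k, n)) :
  altv (rowspan A) = rowspan (alt_mx A).
Proof.
have altE (w : 'rV[F]_n) : alt w = alt_mx w.
  by apply/rowP => j; rewrite /alt_mx mul_mx_diag !mxE mulrC.
apply/vspaceP => w; rewrite mem_altv !mem_rowspan.
apply/submxP/submxP => -[u uE]; exists u.
  by rewrite -[w]altK uE altE /alt_mx mulmxA.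
by rewrite uE mulmxA -/(alt_mx _) -altE altK.
Qed.

Lemma det_colsub_alt k n (A : 'M[F]_(k, n)) (g : 'I_k -> 'I_n) :
  \det (colsub g (alt_mx A)) = (-1) ^+ (\sum_j g j)%N * \det (colsub g A).
Proof.
have -> : colsub g (alt_mx A) = colsub g A *m diag_mx (\row_j (-1) ^+ g j).
  by apply/matrixP => i j; rewrite /alt_mx !mul_mx_diag !mxE.
rewrite det_mulmx det_diag mulrC -prodrXr; congr (_ * _).
by apply: eq_bigr => j _; rewrite mxE.
Qed.

Lemma kcol_inj k n (I : ksubset k n) : injective (kcol I).
Proof. by move=> i j /enum_val_inj/cast_ord_inj. Qed.

Lemma kcol_in k n (I : ksubset k n) i : kcol I i \in val I.
Proof. exact: enum_valP. Qed.

(** The permutation that brings the columns into the order I, J needed for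
Jacobi's identity. *)
Lemma shuffle_perm k m (I : ksubset k (k + m)) (J : ksubset m (k + m)) :
  val I = ~: val J ->
  exists s : 'S_(k + m), [/\ forall i, s (lshift m i) = kcol I i,
    forall j, s (rshift k j) = kcol J j &
    odd_perm s = odd (\sum_(i < k) kcol I i + \sum_(i < k) i)%N].
Proof.
move=> IJ.
pose h i := match split i with inl a => kcol I a | inr b => kcol J b end.
have IJneq a b : kcol I a != kcol J b.
  have := kcol_in I a; rewrite IJ inE; apply: contraNneq => ->.
  exact: kcol_in.
have h_inj : injective h.
  move=> i j; rewrite /h -{2}[i]splitK -{2}[j]splitK.
  case: (split i) (split j) => [a|a] [b|b] /=.
  - by move/kcol_inj ->.
  - by move/eqP; rewrite (negPf (IJneq _ _)).
  - by move/esym/eqP; rewrite (negPf (IJneq _ _)).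
  - by move/kcol_inj ->.
have hl a : perm h_inj (lshift m a) = kcol I a.
  by rewrite permE /h (unsplitK (inl _ a)).
have hr b : perm h_inj (rshift k b) = kcol J b.
  by rewrite permE /h (unsplitK (inr _ b)).
exists (perm h_inj); split=> //; rewrite odd_shuffle.
  by congr (odd (_ + _)); apply: eq_bigr => i _; rewrite hl.
move=> i j; rewrite -[i]splitK -[j]splitK.
case: (split i) (split j) => [a|a] [b|b] /=.
- by move=> lt_ab _; rewrite !hl kcol_mono.
- by move=> _; rewrite ltnNge leq_addr leqNgt ltn_ord.
- by rewrite ltnNge ltnW ?ltn_addr.
- by rewrite ltn_add2l => lt_ab _; rewrite !hr kcol_mono.
Qed.

(** The shuffle contributes (-1)^(sum I), up to a sign depending on k, and
alternation contributes (-1)^(sum J); since sum I + sum J = 0 + ... + (n - 1)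
with n = k + m, the product of the two signs depends on k and m only. *)
Lemma dual_kminor k m (M : 'M[F]_(k + m)) :
  M \in unitmx -> exists2 c : F, c != 0 &
  forall (I : ksubset k (k + m)) (J : ksubset m (k + m)),
  val I = ~: val J ->
  kminor (usubmx M) I = c * kminor (alt_mx (rsubmx (invmx M))^T) J.
Proof.
move=> uM; exists (\det M * (-1) ^+ (\sum_(i < k) i + \sum_(i < k + m) i)%N).
  by rewrite mulf_neq0 ?signr_eq0 // -unitfE -unitmxE.
move=> I J /shuffle_perm[s [sI sJ odd_s]].
have sumE : (\sum_(i < k + m) i = \sum_i kcol I i + \sum_j kcol J j)%N.
  rewrite (reindex_inj (@perm_inj _ s)) big_split_ord /=.
  by congr addn; apply: eq_bigr => i _; rewrite ?sI ?sJ.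
rewrite /kminor det_colsub_alt.
have -> : colsub (kcol I) (usubmx M) =
          colsub (fun i => s (lshift m i)) (usubmx M).
  by apply/matrixP => i j; rewrite !mxE sI.
rewrite complementary_minor // -!mulrA; congr (_ * _); rewrite mulrA.
congr (_ * _); last first.
  by congr (\det _); apply/matrixP => i j; rewrite !mxE sJ.
rewrite odd_s signr_odd -exprD -signr_odd -[RHS]signr_odd; congr (_ ^+ _).
congr nat_of_bool.
by rewrite sumE !oddD -!addbA addbb addbF addbC.
Qed.

(** A common factor c can be moved into a matrix by scaling its first row,
which keeps the row span.  With no row to scale, the only minor is the empty
determinant 1, which is a square. *)
Lemma Gr_ge0_rowspan k n (B : 'M[F]_(k, n)) (c : F) :
  row_free B -> c != 0 -> (forall J, sq_ge0 (c * kminor B J)) ->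
  rowspan B \in Gr_ge0 F k n.
Proof.
move=> B_free c0 cB_ge0; rewrite inE inE dim_rowspan B_free /=.
case: k B B_free cB_ge0 => [|k] B B_free cB_ge0.
  apply/existsP; exists B; rewrite eqxx; apply/forallP => J.
  by apply/sq_ge0P; exists 1; rewrite /kminor det_mx00 expr1n.
pose d : 'rV[F]_k.+1 := \row_j (if j == ord0 then c else 1).
have detd : \det (diag_mx d) = c.
  rewrite det_diag big_ord_recl big1 ?mulr1 ?mxE //.
  by move=> i _; rewrite mxE.
apply/existsP; exists (diag_mx d *m B); apply/andP; split.
  apply/eqP/vspaceP => w; rewrite !mem_rowspan.
  by rewrite eqmxMfull // row_full_unit unitmxE detd unitfE.
by apply/forallP => J; rewrite /kminor -mulmx_colsub det_mulmx detd cB_ge0.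
Qed.

(** The equation k + m = n, rather than n = k + m built into the type of V,
lets the lemma apply with the roles of k and m exchanged. *)
Lemma dual_Gr_ge0 k m n (V : {vspace 'rV[F]_n}) : (k + m)%N = n ->
  V \in Gr_ge0 F k n ->
  altv (perp V) \in Gr_ge0 F m n /\ perp (perp V) = V.
Proof.
move=> def_n; case: n / def_n V => V.
rewrite inE => /andP[]; rewrite inE => dimV /existsP[A].
case/andP=> /eqP defV /forallP A_ge0; rewrite -{V}defV in dimV *.
have A_free : row_free A by rewrite -dim_rowspan.
split; last exact: perp_perp_rowspan.
have [M uM defA] := row_free_complete A_free.
have [c c0 minorE] := dual_kminor uM.
rewrite -defA perp_rowspan_unit // altv_rowspan.
(* alt_mx multiplies by an invertible diagonal matrix, and the last m columns
   of the inverse of M are independent because the last m rows of M form a left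
   inverse of them. *)
apply: (@Gr_ge0_rowspan _ _ _ c) => // [|J].
  rewrite /row_free mxrankMfree; last first.
    rewrite row_free_unit unitmxE det_diag unitrE.
    by rewrite mulrV ?unitr_prod // => i _; rewrite mxE unitrX ?unitrN1.
  rewrite mxrank_tr; apply/row_fullP.
  by exists (dsubmx M); apply: dsub_rsub_invmx.
have cJ : #|~: val J| == k.
  by rewrite cardsCs setCK (eqP (valP J)) card_ord addnK.
pose I : ksubset k (k + m) := Sub (~: val J) cJ.
by rewrite -(minorE I) // defA.
Qed.

End Duality.

Close Scope ring_scope.

Theorem theorem2p2 (F : finFieldType) (k n : nat) (hkn : (k <= n)%N) :
  [/\ forall V : {vspace 'rV[F]_n},
        V \in Gr_ge0 F k n -> altv (perp V) \in Gr_ge0 F (n - k) n,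
      forall V W : {vspace 'rV[F]_n},
        V \in Gr_ge0 F k n -> W \in Gr_ge0 F k n ->
        altv (perp V) = altv (perp W) -> V = W,
      forall W : {vspace 'rV[F]_n}, W \in Gr_ge0 F (n - k) n ->
        exists2 V : {vspace 'rV[F]_n}, V \in Gr_ge0 F k n & altv (perp V) = W
    & #|Gr_ge0 F k n| = #|Gr_ge0 F (n - k) n| ].
Proof.
pose dual (V : {vspace 'rV[F]_n}) := altv (perp V).
have dualP V : V \in Gr_ge0 F k n -> dual V \in Gr_ge0 F (n - k) n.
  by case/(dual_Gr_ge0 (subnKC hkn)).
have dualP' V : V \in Gr_ge0 F (n - k) n -> dual V \in Gr_ge0 F k n.
  by case/(dual_Gr_ge0 (subnK hkn)).
have dualK V : V \in Gr_ge0 F k n -> dual (dual V) = V.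
  by case/(dual_Gr_ge0 (subnKC hkn)) => _ VK; rewrite /dual perp_altv altvK.
have dualK' V : V \in Gr_ge0 F (n - k) n -> dual (dual V) = V.
  by case/(dual_Gr_ge0 (subnK hkn)) => _ VK; rewrite /dual perp_altv altvK.
have dual_inj : {in Gr_ge0 F k n &, injective dual}.
  by move=> V W VG WG eqVW; rewrite -(dualK V VG) eqVW dualK.
split=> //; first by move=> W WG; exists (dual W); rewrite ?dualP' ?[LHS]dualK'.
rewrite -(card_in_imset dual_inj); apply: eq_card => W.
apply/imsetP/idP => [[V VG ->]|WG]; first exact: dualP.
by exists (dual W); rewrite ?dualK' ?dualP'.
Qed.
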